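(* Let $G$ be a finite irreducible directed graph with vertices $v_1,\dots,v_N$ in which every vertex has an incoming edge and an outgoing edge, let $A_G(i,j)$ be the number of edges from $v_i$ to $v_j$, and suppose that the $N\times N$ matrix $A_G$ satisfies condition (C). Let $f_i(x)$, $i=1,\dots,N$, be the functions (given by power series at $0$) satisfying $$f_i(x)=1+x f_i(x)\sum_{j=1}^N A_G(j,i)f_j(x),\qquad i=1,\dots,N.$$ If a real number $x_0$ is the radius of convergence $R_G$ of the functions $f_i(x)$ (which is the same for all $i$), then there exist positive real numbers $t_1,\dots,t_N$ such that $$\det(tA_Gt-x_0)=0,\qquad x_0=t_i-\sum_{j=1}^N t_jA_G(j,i)t_i\quad\text{for } i=1,\dots,N,$$ where $tA_Gt$ is the $N\times N$ matrix $[t_iA_G(i,j)t_j]_{i,j=1,\dots,N}$. In particular, there exists an eigenvector $[s_i]_{i=1,\dots,N}$ of the matrix $tA_Gt$ for the eigenvalue $x_0$ with $\sum_{i=1}^N s_i=1$ such that $$x_0=\frac12\sum_{i=1}^N t_is_i .$$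
   Context: Directed graphs may have loops and multiple edges; $G$ is irreducible if for all vertices $u,v$ there is a directed path from $u$ to $v$. The $f_i$ are the unique power series $f_i(x)=\sum_{n\ge 0}c_n(i)x^n$ satisfying the displayed system (so $c_0(i)=1$ and $c_{n+1}(i)=\sum_{k=0}^n c_{n-k}(i)\sum_{j}A_G(j,i)c_k(j)$); for irreducible $G$ they all have the same positive finite radius of convergence $R_G$. In $tA_Gt-x_0$ the scalar $x_0$ stands for $x_0$ times the identity matrix. Condition (C): for an $N\times N$ matrix $A$ and $t=(t_i)_{i=1}^N\in\mathbb{R}^N$ put $x(t)_i=t_i-\sum_{k=1}^N t_kA(k,i)t_i$ and let $tAt$ be the $N\times N$ matrix with entries $(tAt)(i,j)=t_iA(i,j)t_j$. Let $$C_A=\{t=(t_i)_{i=1}^N\in\mathbb{R}^N\mid t_i>0,\ x(t)_i=x(t)_j>0\text{ for all } i,j=1,\dots,N\},$$ and for $t\in C_A$ write $x(t)$ for the common value of the $x(t)_i$. Let $\widetilde A(i,j)=L_A-A(i,j)$ with $L_A=\max_{i,j}A(i,j)$. The matrix $A$ satisfies condition (C) if $\ker(tAt-x(t))\cap\ker(t\widetilde At+x(t))=\{0\}$ for all $t\in C_A$ (scalars denote multiples of the identity matrix). *)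

(* Defs.v *)
From HB Require Import structures.
From mathcomp Require Import all_boot all_order all_algebra.
From mathcomp Require Import all_classical all_reals all_analysis.

Set Implicit Arguments.
Unset Strict Implicit.
Unset Printing Implicit Defensive.

Import Order.TTheory GRing.Theory Num.Theory.
Import numFieldNormedType.Exports.

Local Open Scope classical_set_scope.
Local Open Scope ring_scope.

(* Edges form a type of their own, so loops and multiple edges are allowed. *)
Record digraph (N : nat) := Digraph {
  edge : finType;
  src : edge -> 'I_N;
  tgt : edge -> 'I_N
}.

Definition edge_rel N (G : digraph N) : rel 'I_N :=
  fun u v => [exists e : edge G, (src e == u) && (tgt e == v)].

Definition irreducible_digraph N (G : digraph N) : Prop :=
  forall u v : 'I_N, connect (edge_rel G) u v.

Definition adjacency (R : realType) N (G : digraph N) : 'M[R]_N :=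
  \matrix_(i < N, j < N) #|[set e : edge G | (src e == i) && (tgt e == j)]%SET|%:R.

(* Kernels and eigenvectors are taken for the action on column vectors; the
   library's kermx and eigenspace refer to row vectors. *)
Definition ker_mx (R : realType) N (M : 'M[R]_N) : set 'cV[R]_N :=
  [set v | M *m v = 0].

Definition is_eigenvector (R : realType) N
    (M : 'M[R]_N) (a : R) (v : 'cV[R]_N) : Prop :=
  v != 0 /\ M *m v = a *: v.

Definition tAt (R : realType) N (t : 'rV[R]_N) (A : 'M[R]_N) : 'M[R]_N :=
  \matrix_(i < N, j < N) (t 0 i * A i j * t 0 j).

Definition xval (R : realType) N (A : 'M[R]_N) (t : 'rV[R]_N) (i : 'I_N) : R :=
  t 0 i - \sum_(k < N) t 0 k * A k i * t 0 i.

Definition C_set (R : realType) N (A : 'M[R]_N) : set 'rV[R]_N :=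
  [set t : 'rV[R]_N | (forall i, 0 < t 0 i) /\
           (forall i j, xval A t i = xval A t j /\ 0 < xval A t j)].

Definition max_entry (R : realType) n (A : 'M[R]_n.+1) : R :=
  \big[Num.max/A ord0 ord0]_(i < n.+1) \big[Num.max/A ord0 ord0]_(j < n.+1) A i j.

Definition tilde_mx (R : realType) n (A : 'M[R]_n.+1) : 'M[R]_n.+1 :=
  \matrix_(i < n.+1, j < n.+1) (max_entry A - A i j).

(* On C_set A, xval A t does not depend on the index; ord0 picks the common
   value x(t). *)
Definition condition_C (R : realType) n (A : 'M[R]_n.+1) : Prop :=
  forall t, C_set A t ->
    let x := xval A t ord0 in
    ker_mx (tAt t A - x%:M) `&` ker_mx (tAt t (tilde_mx A) + x%:M) = [set 0].

Definition conv_radius (R : realType) (a : R^nat) : \bar R :=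
  ereal_sup [set (`|x|)%:E | x in [set x : R | cvgn (pseries a x)]].

Definition power_series_at0 (R : realType) (a : R^nat) (f : R -> R) : Prop :=
  \forall x \near (0 : R), pseries a x @ \oo --> f x.

(* Main.v *)
(* The coefficients of the f_i are nonnegative and t_i = x f_i(x) solves
   t_i = x + t_i (sum_j A(j,i) t_j).  This forces t_j <= 1 below the radius of
   convergence x_0, so the series still converge at x_0 and t_i = x_0 f_i(x_0)
   solves the system there.  Up to a positive diagonal factor, the Jacobian of
   the system at t is the transpose of x_0 - tAt.  Were it invertible, t could
   be perturbed to a positive u with u_i >= y + u_i (sum_j A(j,i) u_j) for some
   y > x_0; such a supersolution dominates the partial sums of the y f_i(y), so
   the series would converge beyond x_0.  This replaces the implicit function
   theorem.  Condition (C) excludes a zero coordinate sum for an eigenvector. *)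
Require Import Defs.
From HB Require Import structures.
From mathcomp Require Import all_boot all_order all_algebra.
From mathcomp Require Import all_classical all_reals all_analysis.
From mathcomp Require Import ring lra.

Set Implicit Arguments.
Unset Strict Implicit.
Unset Printing Implicit Defensive.

Import Order.TTheory GRing.Theory Num.Theory.
Import numFieldNormedType.Exports.

Local Open Scope classical_set_scope.
Local Open Scope ring_scope.

(** * Polynomial expansions at 0 from the right and their uniqueness *)

Section RightExpansion.
Variable R : realType.
Implicit Types (f g : R -> R) (p q : {poly R}) (m : nat).

(** Only positive [x] are considered: there the bound [x ^+ m] needs no absolute value, and one side
    of 0 already determines the coefficients of index below [m]. *)
Definition right_expansion m f p :=
  exists K : R, \forall x \near 0^'+, `|f x - p.[x]| <= K * x ^+ m.

Lemma near_right01 : \forall x \near (0 : R)^'+, 0 < x < 1.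
Proof.
near=> x; apply/andP; split; first by near: x; exact: nbhs_right_gt.
by near: x; exact: nbhs_right_lt.
Unshelve. all: by end_near. Qed.

Lemma horner_bounded p :
  exists2 B : R, 0 <= B & forall x, 0 < x < 1 -> `|p.[x]| <= B.
Proof.
elim/poly_ind: p => [|p a [B B0 pB]].
  by exists 0 => // x _; rewrite horner0 normr0.
exists (B + `|a|) => [|x x01]; first by rewrite addr_ge0.
rewrite hornerMXaddC (le_trans (ler_normD _ _))// lerD2r normrM.
have [x0 x1] := andP x01.
by rewrite -[leRHS]mulr1 ler_pM// ?pB// gtr0_norm// ltW.
Qed.

Lemma right_expansion_poly m p : right_expansion m (horner p) p.
Proof. by exists 0; near=> x; rewrite subrr normr0 mul0r.
Unshelve. all: by end_near. Qed.

Lemma right_expansion_eq m f g p : (\forall x \near 0^'+, f x = g x) ->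
  right_expansion m f p -> right_expansion m g p.
Proof. by move=> fg [K Kf]; exists K; near do rewrite -(near fg _)//.
Unshelve. all: by end_near. Qed.

Lemma right_expansionD m f g p q : right_expansion m f p ->
  right_expansion m g q -> right_expansion m (fun x => f x + g x) (p + q).
Proof.
move=> [K Kf] [L Lg]; exists (K + L); near=> x.
rewrite hornerD opprD addrACA mulrDl (le_trans (ler_normD _ _))// lerD//.
  by near: x.
by near: x.
Unshelve. all: by end_near. Qed.

Lemma right_expansionM m f g p q : right_expansion m f p ->
  right_expansion m g q -> right_expansion m (fun x => f x * g x) (p * q).
Proof.
move=> [K Kf] [L Lg].
have [B B0 pB] := horner_bounded p; have [C C0 qC] := horner_bounded q.
(* With u = f - p and v = g - q, the three terms bound u v, u q and p v in f g - p q. *)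
exists (K * L + K * C + B * L); near=> x.
have x01 : 0 < x < 1 by near: x; exact: near_right01.
have [x0 x1] := andP x01.
have xm0 : 0 <= x ^+ m by rewrite exprn_ge0 ?ltW.
have xm1 : x ^+ m <= 1 by rewrite exprn_ile1 ?ltW.
have df : `|f x - p.[x]| <= K * x ^+ m by near: x.
have dg : `|g x - q.[x]| <= L * x ^+ m by near: x.
(* [L] is nonnegative since [L * x ^+ m] bounds a norm, and [x ^+ m <= 1]. *)
have dgL : `|g x - q.[x]| <= L.
  by rewrite (le_trans dg)// ler_piMr// -(pmulr_lge0 _ (exprn_gt0 m x0)) (le_trans _ dg).
rewrite hornerM; move: df dg dgL; set u := f x - p.[x]; set v := g x - q.[x] => df dg dgL.
have -> : f x * g x - p.[x] * q.[x] = u * v + u * q.[x] + p.[x] * v.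
  by rewrite /u /v; ring.
clearbody u v.
rewrite !mulrDl (le_trans (ler_normD _ _))// lerD//.
  rewrite (le_trans (ler_normD _ _))// lerD//.
    by rewrite normrM mulrAC ler_pM.
  by rewrite normrM mulrAC ler_pM// qC.
by rewrite normrM -mulrA ler_pM// pB.
Unshelve. all: by end_near. Qed.

Lemma right_expansion_sum m (I : finType) (F : I -> R -> R) (P : I -> {poly R}) :
  (forall i, right_expansion m (F i) (P i)) ->
  right_expansion m (fun x => \sum_i F i x) (\sum_i P i).
Proof.
move=> FP; have H (r : seq I) :
    right_expansion m (fun x => \sum_(i <- r) F i x) (\sum_(i <- r) P i).
  elim: r => [|i r IHr].
    under eq_fun do rewrite big_nil; rewrite big_nil.
    apply: right_expansion_eq (right_expansion_poly m 0).
    by near=> x; rewrite horner0.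
  by under eq_fun do rewrite big_cons; rewrite big_cons; exact: right_expansionD.
exact: H.
Unshelve. all: by end_near. Qed.

(** Induction on [m]: letting x tend to 0 kills the constant term, and dividing by X lowers the
    exponent by one. *)
Lemma bigO_poly_coef m p (K : R) :
  (\forall x \near 0^'+, `|p.[x]| <= K * x ^+ m) ->
  forall k, (k < m)%N -> p`_k = 0.
Proof.
elim: m p => // m IHm p; elim/poly_ind: p => [_ k _|p a _ pK].
  by rewrite coef0.
have [B B0 pB] := horner_bounded p.
have a0 : a = 0.
  apply/eqP; rewrite -normr_le0.
  apply: (@cvgr_to_ge _ (0:R)^'+ _ _ (fun x => (`|K| + B) * x) 0 `|a|).
    rewrite -[X in _ --> X](mulr0 (`|K| + B)).
    by apply: cvgMl_tmp => //; exact: cvg_at_right_filter.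
  near=> x.
  have x01 : 0 < x < 1 by near: x; exact: near_right01.
  have [x0 x1] := andP x01.
  have : `|(p * 'X + a%:P).[x]| <= K * x ^+ m.+1 by near: x.
  rewrite hornerMXaddC => h.
  have -> : a = (p.[x] * x + a) - p.[x] * x by ring.
  rewrite (le_trans (ler_normB _ _))// mulrDl lerD//.
    rewrite (le_trans h)// exprS mulrCA mulrC ler_wpM2r ?(ltW x0)//.
    rewrite (le_trans (ler_norm _))// normrM ler_piMr// ger0_norm ?exprn_ile1 ?ltW//.
    by rewrite exprn_gt0.
  by rewrite normrM (gtr0_norm x0) ler_wpM2r ?pB// ltW.
move: pK; rewrite a0 addr0 => pK k.
rewrite coefMX; case: k => [|k]//= km; apply: (IHm p) => //.
near=> x.
have x01 : 0 < x < 1 by near: x; exact: near_right01.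
have [x0 x1] := andP x01.
have : `|(p * 'X).[x]| <= K * x ^+ m.+1 by near: x.
by rewrite hornerMX normrM (gtr0_norm x0) exprSr mulrA ler_pM2r.
Unshelve. all: by end_near. Qed.

Lemma right_expansion_coef m f p q :
  right_expansion m f p -> right_expansion m f q ->
  forall k, (k < m)%N -> p`_k = q`_k.
Proof.
move=> [K Kf] [L Lf] k km; apply/eqP; rewrite -subr_eq0 -coefB; apply/eqP.
apply: (@bigO_poly_coef m _ (K + L)) km; near=> x.
rewrite hornerD hornerN.
have -> : p.[x] - q.[x] = (f x - q.[x]) - (f x - p.[x]) by ring.
rewrite [K + L]addrC mulrDl (le_trans (ler_normB _ _))// lerD//; by near: x.
Unshelve. all: by end_near. Qed.

(** For 0 < x < r and k >= m one has x^k <= r^k (x/r)^m, so the tail from index m on is at most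
    (x/r)^m times the sum of all |a_k| r^k. The bound is proved for partial sums and passes to the
    limit. *)
Lemma power_series_at0_expansion (a : R^nat) f m :
  power_series_at0 a f -> right_expansion m f (\poly_(k < m) a k).
Proof.
move=> /nbhs_ballP[e /= e0 af].
have bE x : ball (0 : R) e x = (`|x| < e) :> Prop.
  by rewrite /ball/= sub0r normrN.
have e2 : 0 < e / 2 by rewrite divr_gt0.
have ce : cvgn (pseries a (e / 2)).
  apply: cvgP; apply: af; rewrite bE gtr0_norm//; lra.
(* The series converges at [e / 2], hence absolutely at the smaller [r]. *)
pose r := e / 4; have r0 : 0 < r by rewrite divr_gt0.
have cr : cvgn (pseries (fun k => `|a k|) r).
  apply: is_cvg_pseries_inside_norm ce _.
  by rewrite !gtr0_norm// /r; lra.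
pose S := limn (pseries (fun k => `|a k|) r).
exists (S / r ^+ m); near=> x.
have x0 : 0 < x by near: x; exact: nbhs_right_gt.
have xr : x < r by near: x; exact: nbhs_right_lt.
have fx : pseries a x @ \oo --> f x.
  by apply: af; rewrite bE gtr0_norm// (lt_trans xr)// /r; lra.
rewrite horner_poly.
apply: (@cvgr_to_le _ \oo _ _ (fun M => `|pseries a x M - \sum_(k < m) a k * x ^+ k|)).
  by apply: cvg_norm; apply: cvgB => //; exact: cvg_cst.
near=> M.
have mM : (m <= M)%N by near: M; exact: nbhs_infty_ge.
rewrite /pseries/series/= (big_cat_nat (leq0n m) mM)//= big_mkord addrAC subrr add0r.
rewrite (le_trans (ler_norm_sum _ _ _))//.
rewrite mulrAC -mulrA -expr_div_n.
apply: (@le_trans _ _ (\sum_(m <= k < M) `|a k| * r ^+ k * (x / r) ^+ m)).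
  rewrite big_nat_cond [leRHS]big_nat_cond.
  apply: ler_sum => k /andP[/andP[mk _] _].
  rewrite normrM -mulrA ler_wpM2l// normrX gtr0_norm//.
  rewrite -{1}(divfK (lt0r_neq0 r0) x) exprMn mulrC ler_wpM2l ?exprn_ge0// ?(ltW r0)//.
  apply: ler_wiXn2l => //; first by rewrite divr_ge0 ?ltW.
  by rewrite ler_pdivrMr// mul1r ltW.
rewrite -mulr_suml ler_wpM2r//; first by rewrite exprn_ge0// divr_ge0 ?(ltW x0) ?(ltW r0).
apply: (@le_trans _ _ (pseries (fun k => `|a k|) r M)).
  rewrite /pseries/series/= [leRHS](big_cat_nat (leq0n m) mM)/= lerDr sumr_ge0// => k _.
  by rewrite mulr_ge0// exprn_ge0// ltW.
apply: nondecreasing_cvgn_le => //; apply: nondecreasing_series => k _ _.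
by rewrite mulr_ge0// exprn_ge0// ltW.
Unshelve. all: by end_near. Qed.

End RightExpansion.

(** * From the functional equation to a recurrence for the coefficients *)

Definition system_coefs (R : realType) (I : finType) (A : I -> I -> R)
    (c : I -> R^nat) :=
  (forall i, c i 0%N = 1) /\
  (forall i n, c i n.+1 =
    \sum_(k < n.+1) c i k * \sum_j A j i * c j (n - k)%N).

(** Truncating every series at order m gives an expansion of each side of the functional equation;
    by uniqueness the two polynomials agree below index m. *)
Lemma power_series_system_coefs (R : realType) (I : finType) (A : I -> I -> R)
    (f : I -> R -> R) (c : I -> R^nat) :
  (forall i, power_series_at0 (c i) (f i)) ->
  (forall i, \forall x \near (0 : R),
     f i x = 1 + x * f i x * \sum_j A j i * f j x) ->
  system_coefs A c.
Proof.
move=> fc feq.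
pose p m i := \poly_(k < m) c i k.
pose q m i := 1 + 'X * p m i * \sum_j (A j i)%:P * p m j.
have coefs m i k : (k < m)%N -> c i k = (q m i)`_k.
  move=> km.
  have -> : c i k = (p m i)`_k by rewrite coef_poly km.
  apply: right_expansion_coef km.
    exact: (power_series_at0_expansion m (fc i)).
  (* Constants and x are written as evaluated polynomials, so that every factor has an expansion. *)
  apply: (@right_expansion_eq _ _
    (fun x => (1 : {poly R}).[x] +
       'X.[x] * f i x * \sum_j (A j i)%:P.[x] * f j x)).
    near=> x; rewrite hornerC hornerX; under eq_bigr do rewrite hornerC.
    by apply/esym; near: x; exact: cvg_within (feq i).
  have ef j := power_series_at0_expansion m (fc j).
  apply: right_expansionD (right_expansion_poly m 1) _.
  apply: right_expansionM.
    exact: right_expansionM (right_expansion_poly m 'X) (ef i).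
  apply: right_expansion_sum => j.
  exact: right_expansionM (right_expansion_poly m (A j i)%:P) (ef j).
split=> [i|i n].
  by rewrite (@coefs 1%N)// coefD -mulrA coefXM coef1 addr0.
(* Order [n.+2] is the least that sees index [n.+1]. The factor X shifts this to index [n] of the
   product, which involves only coefficients surviving the truncation. *)
rewrite (@coefs n.+2)// coefD -mulrA coefXM coef1 add0r coefM.
apply: eq_bigr => k _; rewrite coef_poly (ltn_trans (ltn_ord k))//.
congr (_ * _); rewrite coef_sum; apply: eq_bigr => j _.
by rewrite coefCM coef_poly (leq_ltn_trans (leq_subr _ _)).
Unshelve. all: by end_near. Qed.

(** * Partial sums of the series at nonnegative arguments *)

Section SystemSeries.
Variables (R : realType) (I : finType) (A : I -> I -> R) (c : I -> R^nat).
Hypotheses (A_ge0 : forall i j, 0 <= A i j) (cA : system_coefs A c).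

Lemma system_coefs_ge0 i n : 0 <= c i n.
Proof.
have [c0 cS] := cA.
elim/ltn_ind: n i => -[|n] IHn i; first by rewrite c0.
rewrite cS sumr_ge0// => k _; rewrite mulr_ge0 ?IHn// sumr_ge0// => j _.
by rewrite mulr_ge0// IHn// ltnS leq_subr.
Qed.

(** All terms of the recurrence are nonnegative; keep the one with k = 0 and summation index [j],
    where c_0(i) = 1. *)
Lemma system_coefs_edge i j n : 1 <= A j i -> c j n <= c i n.+1.
Proof.
have [c0 cS] := cA.
move=> Aji; rewrite cS big_ord_recl c0 mul1r subn0 (bigD1 j)//= -addrA.
rewrite -[leLHS]addr0 lerD//.
  by rewrite -[leLHS]mul1r ler_wpM2r// system_coefs_ge0.
rewrite addr_ge0 ?sumr_ge0// => k _; first by rewrite mulr_ge0// system_coefs_ge0.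
rewrite mulr_ge0 ?system_coefs_ge0// sumr_ge0// => l _.
by rewrite mulr_ge0// system_coefs_ge0.
Qed.

(** Both sides sum a_k b_l over the triangle k + l < m. *)
Lemma psum_cauchy_product (a b : R^nat) m :
  \sum_(n < m) \sum_(k < n.+1) a k * b (n - k)%N =
  \sum_(k < m) a k * \sum_(l < m - k) b l.
Proof.
elim: m => [|m IHm]; first by rewrite !big_ord0.
rewrite big_ord_recr/= IHm [RHS]big_ord_recr/= subSnn big_ord1.
rewrite [X in _ + X = _]big_ord_recr/= subnn addrA -big_split/=; congr (_ + _).
apply: eq_bigr => k _; by rewrite subSn 1?ltnW// big_ord_recr/= mulrDr.
Qed.

Let s i m x := \sum_(k < m) c i k * x ^+ k.

Let pseriesE i x m : pseries (c i) x m = s i m x.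
Proof. by rewrite /pseries/series/= big_mkord. Qed.

Let pseries_funE i x : pseries (c i) x = fun m => s i m x.
Proof. by apply/funext => m; rewrite pseriesE. Qed.

Let term_ge0 i k x : 0 <= x -> 0 <= c i k * x ^+ k.
Proof. by move=> x0; rewrite mulr_ge0 ?exprn_ge0 ?system_coefs_ge0. Qed.

Let s_homo i x : 0 <= x -> nondecreasing_seq (fun m => s i m x).
Proof.
move=> x0 m m'; rewrite -!pseriesE => mm'.
by apply: nondecreasing_series mm' => k _ _; exact: term_ge0.
Qed.

Let s_ge0 i m x : 0 <= x -> 0 <= s i m x.
Proof. by move=> x0; apply: sumr_ge0 => k _; exact: term_ge0. Qed.

Let g i m x := \sum_j A j i * s j m x.

Let sS i m x : s i m.+1 x =
  1 + x * \sum_(k < m) c i k * x ^+ k * g i (m - k) x.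
Proof.
have [c0 cS] := cA.
rewrite {1}/s big_ord_recl c0 expr0 mulr1; congr (1 + _).
pose b n := \sum_j A j i * (c j n * x ^+ n).
have gE n : g i n x = \sum_(l < n) b l.
  rewrite /g exchange_big/=; apply: eq_bigr => j _.
  by rewrite mulr_sumr.
under [in RHS]eq_bigr do rewrite gE.
rewrite -(psum_cauchy_product (fun k => c i k * x ^+ k)) mulr_sumr.
apply: eq_bigr => n _; rewrite lift0 cS exprS mulrCA; congr (_ * _).
rewrite mulr_suml; apply: eq_bigr => k _. rewrite -!mulrA; congr (_ * _).
rewrite mulr_suml mulr_sumr; apply: eq_bigr => j _.
have kn : (k <= n)%N by rewrite -ltnS.
have -> : x ^+ n = x ^+ k * x ^+ (n - k) by rewrite -exprD subnKC.
by ring.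
Qed.

(** The triangle k + l < m lies in the square k, l < m. *)
Let sS_le i m x : 0 <= x -> s i m.+1 x <= 1 + x * (s i m x * g i m x).
Proof.
move=> x0; rewrite sS lerD2l ler_wpM2l// mulr_suml; apply: ler_sum => k _.
rewrite ler_wpM2l ?term_ge0//; apply: ler_sum => j _; rewrite ler_wpM2l//.
by apply: s_homo => //; exact: leq_subr.
Qed.

(** The square k, l < m lies in the triangle k + l < 2m. *)
Let sS_ge i m x : 0 <= x ->
  1 + x * (s i m x * g i m x) <= s i (m + m).+1 x.
Proof.
move=> x0; rewrite sS lerD2l ler_wpM2l// big_split_ord/= -[leLHS]addr0 lerD//.
  rewrite mulr_suml; apply: ler_sum => k _.
  rewrite ler_wpM2l ?term_ge0//; apply: ler_sum => j _; rewrite ler_wpM2l//.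
  apply: s_homo => //; rewrite -addnBA ?leq_addr//.
  exact: ltnW.
apply: sumr_ge0 => k _; rewrite mulr_ge0 ?term_ge0// sumr_ge0// => j _.
by rewrite mulr_ge0// s_ge0.
Qed.

(** The right-hand side formed with partial sums of length m lies between the partial sum of length
    m + 1 and the limit, by [sS_le] and [sS_ge], so it is squeezed to the limit. *)
Lemma system_limit_eq x : 0 <= x -> (forall i, cvgn (pseries (c i) x)) ->
  forall i, limn (pseries (c i) x) =
    1 + x * limn (pseries (c i) x) * \sum_j A j i * limn (pseries (c j) x).
Proof.
move=> x0 cx i; set l := fun j => limn (pseries (c j) x).
have sl j : s j m x @[m --> \oo] --> l j by rewrite -pseries_funE; exact: cx.
have gl : g i m x @[m --> \oo] --> \sum_j A j i * l j.
  apply: cvg_big => [|j _]; first exact: add_continuous.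
  exact: cvgMl_tmp.
have Pl : 1 + x * (s i m x * g i m x) @[m --> \oo] -->
    1 + x * (l i * \sum_j A j i * l j).
  by apply: cvgD; [exact: cvg_cst|apply: cvgMl_tmp; exact: cvgM].
rewrite -/(l i) -mulrA; apply/esym/(cvg_unique _ Pl) => //.
apply: (@squeeze_cvgr _ _ _ _ (fun m => s i m.+1 x) (fun=> l i)).
- near=> m; rewrite sS_le//= (le_trans (sS_ge _ _ x0))//.
  by rewrite -pseriesE nondecreasing_cvgn_le// pseries_funE; exact: s_homo.
- by rewrite (cvg_shiftS (fun m => s i m x)).
- exact: cvg_cst.
Unshelve. all: by end_near. Qed.

(** The map sending w to x + w_i (sum_j A(j,i) w_j) is monotone on nonnegative vectors. By [sS_le],
    induction on m keeps x times the partial sums below [u], and bounded nondecreasing sequences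
    converge. *)
Lemma system_cvg_supersolution x (u : I -> R) : 0 < x ->
  (forall i, 0 <= u i) -> (forall i, x + u i * \sum_j A j i * u j <= u i) ->
  forall i, cvgn (pseries (c i) x).
Proof.
move=> x0 u0 ux.
have su m i : x * s i m x <= u i.
  elim: m i => [|m IHm] i; first by rewrite /s big_ord0 mulr0.
  apply: le_trans (ux i); rewrite (le_trans (ler_wpM2l (ltW x0) (sS_le _ _ (ltW x0))))//.
  rewrite mulrDr mulr1 lerD2l mulrA -mulrACA.
  apply: ler_pM => //; first by rewrite mulr_ge0 ?s_ge0 ?(ltW x0).
    rewrite mulr_ge0 ?(ltW x0)// sumr_ge0// => j _.
    by rewrite mulr_ge0// s_ge0// ltW.
  rewrite mulr_sumr; apply: ler_sum => j _.
  by rewrite mulrCA ler_wpM2l.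
move=> i; rewrite pseries_funE; apply: nondecreasing_is_cvgn.
  exact: s_homo (ltW x0).
by exists (u i / x) => _ [m _ <-]; rewrite ler_pdivlMr// mulrC.
Qed.

End SystemSeries.

(** * Common convergence of the series, up to and including the radius *)

Section SystemRadius.
Variables (R : realType) (I : finType) (A : I -> I -> R) (c : I -> R^nat).
Hypotheses (A_ge0 : forall i j, 0 <= A i j) (cA : system_coefs A c).

Let psum_homo i x : 0 <= x -> nondecreasing_seq (pseries (c i) x).
Proof.
move=> x0; apply: nondecreasing_series => k _ _.
by rewrite mulr_ge0 ?exprn_ge0// (system_coefs_ge0 A_ge0 cA).
Qed.

(** By [system_coefs_edge], x times a partial sum for [j] is at most the partial sum for [i] that is
    one term longer. *)
Lemma system_cvg_edge i j x : 0 < x -> 1 <= A j i ->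
  cvgn (pseries (c i) x) -> cvgn (pseries (c j) x).
Proof.
move=> x0 Aji ci; apply: nondecreasing_is_cvgn; first exact: psum_homo (ltW x0).
exists (limn (pseries (c i) x) / x) => _ [m _ <-]; rewrite ler_pdivlMr//.
apply: le_trans (nondecreasing_cvgn_le (psum_homo i (ltW x0)) ci m.+1).
rewrite /pseries/series/= big_nat_recl//= -[leLHS]add0r lerD//.
  by rewrite mulr_ge0// (system_coefs_ge0 A_ge0 cA).
rewrite mulr_suml; apply: ler_sum => k _; rewrite -mulrA -exprSr.
by rewrite ler_wpM2r ?exprn_ge0 ?(ltW x0)// (system_coefs_edge A_ge0 cA).
Qed.

Lemma system_cvg_connect i j x : 0 < x ->
  connect (fun u v => 1 <= A u v) j i ->
  cvgn (pseries (c i) x) -> cvgn (pseries (c j) x).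
Proof.
move=> x0 /connectP[p pth ->].
elim: p j pth => //= k p IHp j /andP[Ajk /IHp pk] /pk.
exact: system_cvg_edge.
Qed.

Let psum_le_lim i x m : 0 <= x -> cvgn (pseries (c i) x) ->
  pseries (c i) x m <= limn (pseries (c i) x).
Proof. by move=> x0 ci; apply: nondecreasing_cvgn_le => //; exact: psum_homo. Qed.

Lemma system_lim_ge1 i x : 0 <= x -> cvgn (pseries (c i) x) ->
  1 <= limn (pseries (c i) x).
Proof.
move=> x0 /(psum_le_lim 1 x0); apply: le_trans.
by rewrite /pseries/series/= big_nat1 expr0 mulr1 (proj1 cA).
Qed.

(* In l_i = 1 + x l_i (sum_j A(j,i) l_j) every term x l_i A(j,i) l_j is at
   most l_i; cancel l_i. *)
Lemma system_lim_bound i j x : 0 <= x -> 1 <= A j i ->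
  (forall k, cvgn (pseries (c k) x)) -> x * limn (pseries (c j) x) <= 1.
Proof.
move=> x0 Aji cx; set l := fun k => limn (pseries (c k) x).
have l1 k : 1 <= l k by exact: system_lim_ge1.
have l0 k : 0 < l k by apply: lt_le_trans (l1 k).
have li : l i = 1 + x * l i * \sum_k A k i * l k := system_limit_eq A_ge0 cA x0 cx i.
rewrite -/(l j) -(ler_pM2l (l0 i)) mulr1 [leRHS]li mulrCA mulrA.
rewrite -[leLHS]add0r lerD// ler_wpM2l//; first by rewrite mulr_ge0// ltW.
rewrite (bigD1 j)//= -[leLHS]addr0 lerD//; first by rewrite ler_peMl// ltW.
by apply: sumr_ge0 => k _; rewrite mulr_ge0// ltW.
Qed.

(** For x < x0 each partial sum times x is at most 1 by [system_lim_bound]. It is a polynomial in x,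
    so the bound persists as x tends to x0 from the left, and the partial sums at x0 are bounded by
    1 / x0. *)
Lemma system_cvg_boundary x0 : 0 < x0 -> (forall j, exists i, 1 <= A j i) ->
  (forall x, 0 < x < x0 -> forall i, cvgn (pseries (c i) x)) ->
  forall i, cvgn (pseries (c i) x0).
Proof.
move=> x0_gt0 outA cx j; have [i Aji] := outA j.
apply: nondecreasing_is_cvgn; first exact: psum_homo (ltW x0_gt0).
exists x0^-1 => _ [m _ <-]; rewrite -[leRHS]mul1r ler_pdivlMr//.
pose p := 'X * \poly_(k < m) c j k.
have pE x : p.[x] = x * pseries (c j) x m.
  by rewrite hornerM hornerX horner_poly /pseries/series/= big_mkord.
rewrite mulrC -pE.
apply: (@cvgr_to_le _ x0^'- _ _ (horner p)).
  by apply: cvg_at_left_filter; exact: continuous_horner.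
near=> x.
have x_gt0 : 0 < x by near: x; exact: nbhs_left_gt.
have x01 : x < x0 by near: x; exact: nbhs_left_lt.
have cxx : forall k, cvgn (pseries (c k) x) by apply: cx; rewrite x_gt0.
apply: le_trans (system_lim_bound (ltW x_gt0) Aji cxx).
by rewrite pE ler_wpM2l ?(ltW x_gt0)// psum_le_lim// ltW.
Unshelve. all: by end_near. Qed.

End SystemRadius.

(** * Perturbing a nonsingular solution *)

(* If v (x - tAt) is the all-ones row, then u_i = t_i (1 + e v_i) gives
   u_i - u_i (sum_j A(j,i) u_j) = x + e - O(e^2). *)
Lemma nonsingular_supersolution (R : realType) N (A : 'M[R]_N) (t : 'rV[R]_N)
    (x : R) :
  (forall i, 0 < t 0 i) ->
  (forall i, x = t 0 i - \sum_j t 0 j * A j i * t 0 i) ->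
  \det (tAt t A - x%:M) != 0 ->
  exists2 y, x < y & exists2 u : 'I_N -> R, forall i, 0 < u i &
    forall i, y + u i * \sum_j A j i * u j <= u i.
Proof.
move=> t0 xt; rewrite -unitfE -unitmxE => unitM.
pose v : 'rV[R]_N := const_mx (-1) *m invmx (tAt t A - x%:M).
have vM : v *m (tAt t A - x%:M) = const_mx (-1) by rewrite mulmxKV.
clearbody v.
have vE i : v 0 i * x - \sum_j v 0 j * (t 0 j * A j i * t 0 i) = 1.
  move/(congr1 (fun w : 'rV[R]_N => w 0 i)): vM.
  rewrite mulmxBr mul_mx_scalar !mxE; under eq_bigr do rewrite mxE.
  by move=> vi; lra.
(* The error term is exactly - e^2 [q i]. The constant [B] dominates every |q_i| and |v_i|; its
   summand 1 makes it positive. *)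
pose q i := t 0 i * v 0 i * \sum_j A j i * (t 0 j * v 0 j).
pose B := 1 + \sum_i (`|q i| + `|v 0 i|).
have B1 : 1 <= B by rewrite lerDl sumr_ge0// => i _; rewrite addr_ge0.
have B0 : 0 < B by apply: lt_le_trans B1.
have qvB i : `|q i| + `|v 0 i| <= B.
  rewrite /B (bigD1 i)//= -[leLHS]add0r lerD// -[leLHS]addr0 lerD//.
  by apply: sumr_ge0 => k _; rewrite addr_ge0.
(* Then e |v_i| <= 1/2 keeps [u] positive, and e^2 q_i <= e/2 leaves a gain of at least e/2, whence
   y = x + e/2. *)
pose e := (2 * B)^-1.
have e0 : 0 < e by rewrite invr_gt0 mulr_gt0.
have eB : e * B = 2^-1 by rewrite /e invfM -mulrA mulVf ?mulr1// gt_eqF.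
have eqv i : e * `|q i| <= 2^-1 /\ e * `|v 0 i| <= 2^-1.
  by split; rewrite -eB ler_wpM2l ?(ltW e0)//; apply: le_trans (qvB i);
    rewrite ?lerDl ?lerDr.
exists (x + e / 2); first by rewrite ltrDl divr_gt0.
exists (fun i => t 0 i * (1 + e * v 0 i)) => i.
  rewrite mulr_gt0//; have [_] := eqv i.
  rewrite -{1}(gtr0_norm e0) -normrM ler_norml => /andP[+ _]; lra.
have -> : \sum_j A j i * (t 0 j * (1 + e * v 0 j)) =
    \sum_j A j i * t 0 j + e * \sum_j A j i * (t 0 j * v 0 j).
  by rewrite mulr_sumr -big_split/=; apply: eq_bigr => j _; ring.
have qi : e * q i <= 2^-1.
  by apply: le_trans (proj1 (eqv i)); rewrite ler_wpM2l ?(ltW e0)// ler_norm.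
have vi := vE i; have xi := xt i.
have E1 : \sum_j t 0 j * A j i * t 0 i = t 0 i * \sum_j A j i * t 0 j.
  by rewrite mulr_sumr; apply: eq_bigr => j _; ring.
have E2 : \sum_j v 0 j * (t 0 j * A j i * t 0 i) =
    t 0 i * \sum_j A j i * (t 0 j * v 0 j).
  by rewrite mulr_sumr; apply: eq_bigr => j _; ring.
move: xi vi qi; rewrite E1 E2 /q.
set a := \sum_j A j i * t 0 j; set b := \sum_j A j i * (t 0 j * v 0 j).
move: (t 0 i) (v 0 i) a b => ti wi a b xi vi qi.
have : e * (e * (ti * wi * b)) <= e * 2^-1 by rewrite ler_wpM2l ?(ltW e0).
(* Inserting this factor 1 and then x = ti - ti a turns the expansion into a polynomial identity. *)
have ee : e = e * (wi * x - ti * b) by rewrite vi mulr1.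
have : ti * (1 + e * wi) =
    x + e + ti * (1 + e * wi) * (a + e * b) - e * (e * (ti * wi * b)).
  by rewrite [X in x + X + _ - _]ee xi; ring.
move: (e * (e * _)) (ti * _ * (a + _)) => ebb ua; lra.
Qed.

(** * Radius of convergence and adjacency matrix *)

Lemma conv_radius_cvg (R : realType) (a : R^nat) (x : R) :
  (`|x|%:E < conv_radius a)%E -> cvgn (pseries a x).
Proof.
move=> /ereal_sup_gt[_ [y ay <-]]; rewrite lte_fin.
exact: is_cvg_pseries_inside ay.
Qed.

Lemma conv_radius_ge (R : realType) (a : R^nat) (x : R) :
  cvgn (pseries a x) -> (`|x|%:E <= conv_radius a)%E.
Proof. by move=> ax; apply: ereal_sup_ubound; exists x. Qed.

Lemma conv_radius_gt0 (R : realType) (a : R^nat) (f : R -> R) :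
  power_series_at0 a f -> (0 < conv_radius a)%E.
Proof.
move=> af.
have afr : \forall x \near (0 : R)^'+, pseries a x @ \oo --> f x.
  exact: cvg_within af.
near (0 : R)^'+ => x.
have x0 : 0 < x by near: x; exact: nbhs_right_gt.
apply: (@lt_le_trans _ _ `|x|%:E); first by rewrite lte_fin gtr0_norm.
by apply: conv_radius_ge; apply: (cvgP (f x)); near: x.
Unshelve. all: by end_near. Qed.

Lemma adjacency_ge0 (R : realType) N (G : digraph N) i j :
  0 <= adjacency R G i j.
Proof. by rewrite mxE. Qed.

Lemma adjacency_edge (R : realType) N (G : digraph N) (e : edge G) :
  1 <= adjacency R G (src e) (tgt e).
Proof. by rewrite mxE ler1n; apply/card_gt0P; exists e; rewrite inE !eqxx. Qed.

Lemma adjacency_connect (R : realType) N (G : digraph N) u v :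
  irreducible_digraph G -> connect (fun i j => 1 <= adjacency R G i j) u v.
Proof.
move=> /(_ u v); apply: connect_sub => i j /existsP[e /andP[/eqP<- /eqP<-]].
exact/connect1/adjacency_edge.
Qed.

(** * Eigenvectors of [tAt] and their coordinate sums *)

(* Summing the eigenvalue equation over the rows and using
   sum_i t_i A(i,j) t_j = t_j - x. *)
Lemma tAt_eigenvector_sum (R : realType) N (A : 'M[R]_N) (t : 'rV[R]_N)
    (s : 'cV[R]_N) (x : R) :
  (forall i, x = t 0 i - \sum_j t 0 j * A j i * t 0 i) ->
  tAt t A *m s = x *: s ->
  \sum_i t 0 i * s i 0 = 2 * x * \sum_i s i 0.
Proof.
move=> xt ts.
have : \sum_i (tAt t A *m s) i 0 = x * \sum_i s i 0.
  by rewrite ts mulr_sumr; apply: eq_bigr => i _; rewrite mxE.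
under eq_bigr do rewrite mxE.
rewrite exchange_big/= => h.
rewrite -mulrA mulr_natl mulr2n -{1}h mulr_sumr -big_split/=.
apply: eq_bigr => j _; rewrite -mulr_suml -mulrDl; congr (_ * _).
rewrite {1}(xt j); under [in RHS]eq_bigr do rewrite mxE.
by rewrite addrC subrK.
Qed.

(* If sum_i s_i = 0 then s also lies in the kernel of t A~ t + x. *)
Lemma condition_C_sum_neq0 (R : realType) n (A : 'M[R]_n.+1) (t : 'rV[R]_n.+1)
    (s : 'cV[R]_n.+1) (x : R) :
  condition_C A -> 0 < x -> (forall i, 0 < t 0 i) ->
  (forall i, x = t 0 i - \sum_j t 0 j * A j i * t 0 i) ->
  is_eigenvector (tAt t A) x s -> \sum_i s i 0 != 0.
Proof.
move=> AC x0 t0 xt [s0 ts]; apply: contra_neq s0 => sum0.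
have xv i : xval A t i = x by rewrite (xt i).
have Ct : C_set A t by split=> // i j; rewrite !xv.
have := AC t Ct; rewrite /= xv => kers.
suff : [set 0 : 'cV[R]_n.+1] s by [].
rewrite -kers; split; rewrite /ker_mx/= ?mulmxBl ?mulmxDl mul_scalar_mx.
  by rewrite ts subrr.
(* Replacing x s by (tAt) s cancels the entries of [A]: row i becomes t_i L_A (sum_k t_k s_k), and
   this sum is 2 x (sum_k s_k) = 0. *)
rewrite -ts -mulmxDl; apply/matrixP => i j; rewrite !mxE.
rewrite (ord1 j) (eq_bigr (fun k => t 0 i * max_entry A * (t 0 k * s k 0))).
  by rewrite -mulr_sumr (tAt_eigenvector_sum xt ts) sum0 !mulr0.
by move=> k _; rewrite !mxE; ring.
Qed.
Theorem theorem7p2 (R : realType) (n : nat) (G : digraph n.+1)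
  (G_irr : irreducible_digraph G)
  (G_in : forall v, exists e : edge G, tgt e = v)
  (G_out : forall v, exists e : edge G, src e = v)
  (G_C : condition_C (adjacency R G))
  (f : 'I_n.+1 -> R -> R) (c : 'I_n.+1 -> R^nat)
  (f_series : forall i, power_series_at0 (c i) (f i))
  (f_eq : forall i, \forall x \near (0 : R),
     f i x = 1 + x * f i x * \sum_(j < n.+1) adjacency R G j i * f j x)
  (x0 : R) (i0 : 'I_n.+1) (x0_radius : conv_radius (c i0) = x0%:E) :
  exists t : 'rV[R]_n.+1,
    [/\ forall i, 0 < t 0 i,
        \det (tAt t (adjacency R G) - x0%:M) = 0,
        forall i, x0 = t 0 i - \sum_(j < n.+1) t 0 j * adjacency R G j i * t 0 i
      & exists s : 'cV[R]_n.+1,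
          [/\ is_eigenvector (tAt t (adjacency R G)) x0 s,
              \sum_(i < n.+1) s i 0 = 1
            & x0 = 2^-1 * \sum_(i < n.+1) t 0 i * s i 0]].
Proof.
set A := adjacency R G in G_C f_eq *.
have A_ge0 i j : 0 <= A i j by exact: adjacency_ge0.
have cA : system_coefs (fun i j => A i j) c.
  exact: power_series_system_coefs f_series f_eq.
have outA j : exists i, 1 <= A j i.
  by have [e <-] := G_out j; exists (tgt e); exact: adjacency_edge.
have x0_gt0 : 0 < x0 by rewrite -lte_fin -x0_radius (conv_radius_gt0 (f_series i0)).
have cvg_x0 : forall i, cvgn (pseries (c i) x0).
  apply: (system_cvg_boundary A_ge0 cA) => // x /andP[x_gt0 xx0] i.
  (* The radius is known for [i0] only; a path from [i] to [i0] carries convergence over to [i]. *)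
  apply: (system_cvg_connect A_ge0 cA x_gt0 (adjacency_connect R i i0 G_irr)).
  by apply: conv_radius_cvg; rewrite x0_radius lte_fin gtr0_norm.
(* The functions [f i] are tied to their series only near 0, so the sum of the series stands for the
   value at [x0]. *)
pose t : 'rV[R]_n.+1 := \row_i (x0 * limn (pseries (c i) x0)).
have t_gt0 i : 0 < t 0 i.
  rewrite mxE mulr_gt0// (lt_le_trans ltr01)//.
  exact: (system_lim_ge1 A_ge0 cA (ltW x0_gt0)).
have tE i : x0 = t 0 i - \sum_(j < n.+1) t 0 j * A j i * t 0 i.
  have li := system_limit_eq A_ge0 cA (ltW x0_gt0) cvg_x0 i.
  have -> : \sum_(j < n.+1) t 0 j * A j i * t 0 i = x0 * (x0 *
      limn (pseries (c i) x0) * \sum_j A j i * limn (pseries (c j) x0)).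
    by rewrite !mulr_sumr; apply: eq_bigr => j _; rewrite !mxE; ring.
  by rewrite mxE {1}li mulrDr mulr1 addrK.
have det0 : \det (tAt t A - x0%:M) = 0.
  apply/eqP/negPn/negP => /(nonsingular_supersolution t_gt0 tE)[y xy [u u_gt0 uy]].
  have y_gt0 : 0 < y by exact: lt_trans xy.
  have cy : cvgn (pseries (c i0) y).
    by apply: (system_cvg_supersolution A_ge0 cA y_gt0 _ uy) => i; exact: ltW.
  have := conv_radius_ge cy.
  by rewrite x0_radius lee_fin gtr0_norm// leNgt xy.
have [s s_eig] : exists s, is_eigenvector (tAt t A) x0 s.
  (* [det0P] yields a row vector, so it is applied to the transpose to obtain a column
     eigenvector. *)
  have /eqP/det0P[w w0 wM] : \det (tAt t A - x0%:M)^T = 0 by rewrite det_tr.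
  exists w^T; split; first by rewrite trmx_eq0.
  move/(congr1 trmx): wM; rewrite trmx_mul trmxK trmx0 mulmxBl mul_scalar_mx.
  by move/eqP; rewrite subr_eq0 => /eqP.
have sum_neq0 := condition_C_sum_neq0 G_C x0_gt0 t_gt0 tE s_eig.
have [s0 ts] := s_eig.
pose s' := (\sum_i s i 0)^-1 *: s.
have ts' : tAt t A *m s' = x0 *: s' by rewrite -scalemxAr ts scalerA mulrC -scalerA.
have sum1 : \sum_i s' i 0 = 1.
  by under eq_bigr do rewrite mxE; rewrite -mulr_sumr mulVf.
exists t; split=> //; exists s'; split=> //.
  by split=> //; rewrite scaler_eq0 invr_eq0 negb_or sum_neq0.
by rewrite (tAt_eigenvector_sum tE ts') sum1 mulr1 mulKf.
Qed.
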